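(* Let $n$ be a positive integer. For a partition $\lambda$ of length at most $n$, writing $\lambda+1^n=(\lambda_1+1,\dots,\lambda_n+1)$, \[ \mathrm{rs}_{\lambda,\lambda}=\mathrm{so}_\lambda\,\mathrm{so}^-_\lambda,\qquad \mathrm{rs}_{\lambda+1^n,\lambda}=\mathrm{o}_{\lambda+1^n}\,\mathrm{sp}_\lambda. \] Moreover, for a partition $\lambda$ of length at most $n+1$, \[ \mathrm{rs}_{(\lambda_1,\dots,\lambda_n),(\lambda_2,\dots,\lambda_{n+1})}+\mathrm{rs}_{(\lambda_1-1,\dots,\lambda_{n+1}-1),(\lambda_2+1,\dots,\lambda_n+1)}=\mathrm{sp}_{(\lambda_1,\dots,\lambda_n)}\,\mathrm{o}_{(\lambda_2,\dots,\lambda_{n+1})}, \] and \[ \mathrm{rs}_{(\lambda_1+1,\dots,\lambda_n+1),(\lambda_2,\dots,\lambda_{n+1})}+\mathrm{rs}_{(\lambda_1,\dots,\lambda_{n+1}),(\lambda_2+1,\dots,\lambda_n+1)}=\mathrm{so}_{(\lambda_1+1,\dots,\lambda_n+1)}\,\mathrm{so}^-_{(\lambda_2,\dots,\lambda_{n+1})}. \]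
   Context: $\Lambda$ is the ring of symmetric functions; $h_r$ complete homogeneous symmetric functions, $h_0=1$, $h_r=0$ for $r<0$. For a weakly decreasing integer sequence $\alpha=(\alpha_1,\dots,\alpha_N)$: $\mathrm{o}_\alpha=\det_{1\le i,j\le N}(h_{\alpha_i-i+j}-h_{\alpha_i-i-j})$, $\mathrm{sp}_\alpha=\tfrac12\det_{1\le i,j\le N}(h_{\alpha_i-i+j}+h_{\alpha_i-i-j+2})$, $\mathrm{so}_\alpha=\det_{1\le i,j\le N}(h_{\alpha_i-i+j}+h_{\alpha_i-i-j+1})$, $\mathrm{so}^-_\alpha=\det_{1\le i,j\le N}(h_{\alpha_i-i+j}-h_{\alpha_i-i-j+1})$ (for partitions these do not depend on padding with zeros). For sequences $\alpha$ of length $N$ and $\beta$ of length $M$, \[ \mathrm{rs}_{\alpha,\beta}=\det\begin{pmatrix}(h_{\alpha_i-i+j})_{1\le i,j\le N}&(h_{\alpha_i-i-j+1})_{1\le i\le N,1\le j\le M}\\(h_{\beta_i-i-j+1})_{1\le i\le M,1\le j\le N}&(h_{\beta_i-i+j})_{1\le i,j\le M}\end{pmatrix}; \] for partitions $\alpha,\beta$ this equals $\sum_\nu(-1)^{|\nu|}s_{\alpha/\nu}s_{\beta/\nu'}$, where $s_{\lambda/\mu}=\det(h_{\lambda_i-\mu_j-i+j})$ is the skew Schur function and $\nu'$ the conjugate partition. *)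

(* Defs.v *)
From HB Require Import structures.
From mathcomp Require Import all_boot all_order all_fingroup all_algebra.
From mathcomp Require Import boolp.
From mathcomp Require Import mpoly.

Set Implicit Arguments.
Unset Strict Implicit.
Unset Printing Implicit Defensive.

Import GRing.Theory.
Local Open Scope ring_scope.

(* The specialisation x_n := 0, R[x_0,...,x_n] -> R[x_0,...,x_{n-1}]. *)
Definition drop_last (R : comNzRingType) (n : nat) (p : {mpoly R[n.+1]}) :
  {mpoly R[n]} :=
  mmap (@mpolyC n R)
    (fun i => if unlift ord_max i is Some j then 'X_j else 0) p.

(* The ring of symmetric functions over R, in infinitely many variables:
   compatible families of symmetric polynomials in x_0, ..., x_{n-1}
   (n = 0, 1, 2, ...) of bounded degree.  In multinomials, msize p is
   1 + the total degree of p (and msize 0 = 0). *)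
Record symfun (R : comNzRingType) := SymFun {
  symfun_val : forall n, {mpoly R[n]};
  symfun_sym : forall n, symfun_val n \is symmetric;
  symfun_drop : forall n, drop_last (symfun_val n.+1) = symfun_val n;
  symfun_bounded : exists d, forall n, (msize (symfun_val n) <= d)%N
}.

Section SymFunTheory.
Variable R : comNzRingType.
Implicit Types f g : symfun R.

Lemma symfunP f g : (forall n, symfun_val f n = symfun_val g n) -> f = g.
Proof.
case: f g => f fs fd fb [g gs gd gb] /= fg.
have {}fg : f = g by apply: functional_extensionality_dep.
subst g; rewrite (Prop_irrelevance fs gs) (Prop_irrelevance fd gd).
by rewrite (Prop_irrelevance fb gb).
Qed.

HB.instance Definition _ := gen_eqMixin (symfun R).
HB.instance Definition _ := gen_choiceMixin (symfun R).

Lemma drop_lastN n : {morph @drop_last R n : p / - p}.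
Proof. exact: raddfN. Qed.
Lemma drop_lastD n : {morph @drop_last R n : p q / p + q}.
Proof. exact: raddfD. Qed.
Lemma drop_lastM n : {morph @drop_last R n : p q / p * q}.
Proof. exact: rmorphM. Qed.

Fact symfun0_bounded : exists d, forall n, (msize (0 : {mpoly R[n]}) <= d)%N.
Proof. by exists 0%N => n; rewrite msize0. Qed.

Definition symfun0 : symfun R :=
  SymFun (fun n => rpred0 _) (fun n => raddf0 _) symfun0_bounded.

Fact symfun1_bounded : exists d, forall n, (msize (1 : {mpoly R[n]}) <= d)%N.
Proof. by exists 1%N => n; rewrite msize1. Qed.

Definition symfun1 : symfun R :=
  SymFun (fun n => rpred1 _) (fun n => rmorph1 _) symfun1_bounded.

Section Operations.
Variables (f g : symfun R) (c : R).

Fact symfunN_sym n : - symfun_val f n \is symmetric.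
Proof. by rewrite rpredN symfun_sym. Qed.

Fact symfunN_drop n :
  drop_last (- symfun_val f n.+1) = - symfun_val f n.
Proof. by rewrite drop_lastN symfun_drop. Qed.

Fact symfunN_bounded : exists d, forall n, (msize (- symfun_val f n) <= d)%N.
Proof.
by case: (symfun_bounded f) => d fd; exists d => n; rewrite msizeN.
Qed.

Definition symfunN : symfun R :=
  SymFun symfunN_sym symfunN_drop symfunN_bounded.

Fact symfunD_sym n : symfun_val f n + symfun_val g n \is symmetric.
Proof. by rewrite rpredD ?symfun_sym. Qed.

Fact symfunD_drop n :
  drop_last (symfun_val f n.+1 + symfun_val g n.+1) =
  symfun_val f n + symfun_val g n.
Proof. by rewrite drop_lastD !symfun_drop. Qed.

Fact symfunD_bounded :
  exists d, forall n, (msize (symfun_val f n + symfun_val g n) <= d)%N.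
Proof.
case: (symfun_bounded f) (symfun_bounded g) => d fd [e ge].
exists (maxn d e) => n; apply: leq_trans (msizeD_le _ _) _.
by rewrite geq_max !leq_max fd ge orbT.
Qed.

Definition symfunD : symfun R :=
  SymFun symfunD_sym symfunD_drop symfunD_bounded.

Fact symfunM_sym n : symfun_val f n * symfun_val g n \is symmetric.
Proof. by rewrite rpredM ?symfun_sym. Qed.

Fact symfunM_drop n :
  drop_last (symfun_val f n.+1 * symfun_val g n.+1) =
  symfun_val f n * symfun_val g n.
Proof. by rewrite drop_lastM !symfun_drop. Qed.

Fact symfunM_bounded :
  exists d, forall n, (msize (symfun_val f n * symfun_val g n) <= d)%N.
Proof.
case: (symfun_bounded f) (symfun_bounded g) => d fd [e ge].
exists (d + e).+1 => n; apply: leq_trans (msizeM_le _ _) _.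
by rewrite ltnS leq_add.
Qed.

Definition symfunM : symfun R :=
  SymFun symfunM_sym symfunM_drop symfunM_bounded.

Fact symfunZ_sym n : c *: symfun_val f n \is symmetric.
Proof. by rewrite rpredZ ?symfun_sym. Qed.

Fact symfunZ_drop n :
  drop_last (c *: symfun_val f n.+1) = c *: symfun_val f n.
Proof. by rewrite /drop_last mmapZ mul_mpolyC -/(drop_last _) symfun_drop. Qed.

Fact symfunZ_bounded :
  exists d, forall n, (msize (c *: symfun_val f n) <= d)%N.
Proof.
case: (symfun_bounded f) => d fd; exists d => n.
exact: leq_trans (msizeZ_le _ _) _.
Qed.

Definition symfunZ : symfun R :=
  SymFun symfunZ_sym symfunZ_drop symfunZ_bounded.

End Operations.

Fact symfun_addA : associative symfunD.
Proof. by move=> f g h; apply: symfunP => n /=; rewrite addrA. Qed.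
Fact symfun_addC : commutative symfunD.
Proof. by move=> f g; apply: symfunP => n /=; rewrite addrC. Qed.
Fact symfun_add0 : left_id symfun0 symfunD.
Proof. by move=> f; apply: symfunP => n /=; rewrite add0r. Qed.
Fact symfun_addN : left_inverse symfun0 symfunN symfunD.
Proof. by move=> f; apply: symfunP => n /=; rewrite addNr. Qed.

HB.instance Definition _ := GRing.isZmodule.Build (symfun R)
  symfun_addA symfun_addC symfun_add0 symfun_addN.

Fact symfun_mulA : associative symfunM.
Proof. by move=> f g h; apply: symfunP => n /=; rewrite mulrA. Qed.
Fact symfun_mulC : commutative symfunM.
Proof. by move=> f g; apply: symfunP => n /=; rewrite mulrC. Qed.
Fact symfun_mul1 : left_id symfun1 symfunM.
Proof. by move=> f; apply: symfunP => n /=; rewrite mul1r. Qed.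
Fact symfun_mulDl : left_distributive symfunM symfunD.
Proof. by move=> f g h; apply: symfunP => n /=; rewrite mulrDl. Qed.
Fact symfun1_neq0 : symfun1 != symfun0 :> symfun R.
Proof.
apply/eqP => /(congr1 (fun f => symfun_val f 0%N)) /= /eqP.
by rewrite oner_eq0.
Qed.

HB.instance Definition _ := GRing.Zmodule_isComNzRing.Build (symfun R)
  symfun_mulA symfun_mulC symfun_mul1 symfun_mulDl symfun1_neq0.

Fact symfun_scaleA a b f : symfunZ (symfunZ f b) a = symfunZ f (a * b).
Proof. by apply: symfunP => n /=; rewrite scalerA. Qed.
Fact symfun_scale1 : left_id 1 (fun a f => symfunZ f a).
Proof. by move=> f; apply: symfunP => n /=; rewrite scale1r. Qed.
Fact symfun_scaleDr : right_distributive (fun a f => symfunZ f a) +%R.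
Proof. by move=> a f g; apply: symfunP => n /=; rewrite scalerDr. Qed.
Fact symfun_scaleDl f : {morph (fun a => symfunZ f a) : a b / a + b}.
Proof. by move=> a b; apply: symfunP => n /=; rewrite scalerDl. Qed.

HB.instance Definition _ := GRing.Zmodule_isLmodule.Build R (symfun R)
  symfun_scaleA symfun_scale1 symfun_scaleDr symfun_scaleDl.

Fact symfun_scaleAl (a : R) f g : a *: (f * g) = a *: f * g.
Proof. by apply: symfunP => n /=; rewrite scalerAl. Qed.

HB.instance Definition _ := GRing.Lmodule_isLalgebra.Build R (symfun R)
  symfun_scaleAl.

Fact symfun_scaleAr (a : R) f g : a *: (f * g) = f * (a *: g).
Proof. by apply: symfunP => n /=; rewrite scalerAr. Qed.

HB.instance Definition _ := GRing.Lalgebra_isAlgebra.Build R (symfun R)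
  symfun_scaleAr.

(* The sum of all monomials of degree r in n variables. *)
Definition hpoly (r n : nat) : {mpoly R[n]} :=
  \sum_(m : 'X_{1..n < r.+1} | mdeg m == r) 'X_[m].

Lemma mcoeff_hpoly r n (m : 'X_{1..n}) : (hpoly r n)@_m = (mdeg m == r)%:R.
Proof.
rewrite /hpoly raddf_sum /=; have [mr|mr] := eqVneq (mdeg m) r; last first.
  rewrite big1 // => k /eqP kr; rewrite mcoeffX.
  by case: eqP => // km; rewrite -km kr eqxx in mr.
have lt_m : (mdeg m < r.+1)%N by rewrite mr.
rewrite (bigD1 (BMultinom lt_m)) /= ?mr //= mcoeffX eqxx big1 ?addr0 //.
move=> k /andP[_ kN]; rewrite mcoeffX; case: eqP => // km.
by case/eqP: kN; apply: val_inj.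
Qed.

Fact hpoly_sym r n : hpoly r n \is symmetric.
Proof.
by apply/issymP => s; apply/mpolyP => m; rewrite mcoeff_sym !mcoeff_hpoly mdeg_mperm.
Qed.

Fact hpoly_bounded r : exists d, forall n, (msize (hpoly r n) <= d)%N.
Proof.
exists r.+1 => n; rewrite /hpoly.
elim/big_ind: _ => [|p q pr qr|m /eqP mr]; first by rewrite msize0.
  by apply: leq_trans (msizeD_le _ _) _; rewrite geq_max pr.
by rewrite msizeX mr.
Qed.

Let widen_max n (i : 'I_n) : widen_ord (leqnSn n) i = lift ord_max i.
Proof. by apply: val_inj; rewrite [RHS]lift_max. Qed.

Lemma drop_lastX n (k : 'X_{1..n.+1}) :
  drop_last 'X_[k] =
  (k ord_max == 0%N)%:R *: 'X_[[multinom k (lift ord_max i) | i < n]]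
  :> {mpoly R[n]}.
Proof.
rewrite /drop_last mmapX /mmap1 big_ord_recr /= unlift_none.
rewrite expr0n scaler_nat mulr_natr; congr (_ *+ _).
rewrite (mpolyXE_id R); apply: eq_bigr => i _.
by rewrite mnmE widen_max liftK.
Qed.

Lemma mcoeff_drop_last n (p : {mpoly R[n.+1]}) (m : 'X_{1..n}) :
  (drop_last p)@_m =
  p@_[multinom if unlift ord_max i is Some j then m j else 0%N | i < n.+1].
Proof.
set m' := (X in p@_X); rewrite {1}(mpolyE p) [drop_last _]raddf_sum /=.
rewrite raddf_sum /= [in RHS](mpolyE p) raddf_sum /=.
apply: eq_bigr => k _; rewrite [mmap _ _ _]mmapZ mul_mpolyC -/(drop_last _).
rewrite drop_lastX !mcoeffZ !mcoeffX; congr (_ * _).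
rewrite -natrM mulnb; congr (_ %:R); congr nat_of_bool.
apply/andP/eqP => [[/eqP k0 /eqP km]|->]; last first.
  split; first by rewrite mnmE unlift_none.
  by apply/eqP/mnmP => i; rewrite !mnmE liftK.
apply/mnmP => i; rewrite mnmE; case: unliftP => [j ->|->]; last by [].
by rewrite -km mnmE.
Qed.

Fact hpoly_drop r n : drop_last (hpoly r n.+1) = hpoly r n.
Proof.
apply/mpolyP => m; rewrite mcoeff_drop_last !mcoeff_hpoly !mdegE.
rewrite big_ord_recr /= mnmE unlift_none addn0.
congr ((_ == _)%:R); apply: eq_bigr => i _.
by rewrite mnmE widen_max liftK.
Qed.

Definition hsym (r : nat) : symfun R :=
  SymFun (hpoly_sym r) (hpoly_drop r) (hpoly_bounded r).

Lemma hsym0 : hsym 0 = 1.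
Proof.
apply: symfunP => n /=; apply/mpolyP => m.
by rewrite mcoeff_hpoly mcoeff1 mdeg_eq0.
Qed.

End SymFunTheory.

(* Rational coefficients, so that the factor 1/2 of sp_det makes sense. *)
Notation Lambda := (symfun rat).

Definition hZ (k : int) : Lambda := if k is Posz r then hsym rat r else 0.

(* A sequence (a_1, ..., a_N) of integers is a function 'I_N -> int, with
   a_i = a (i - 1); in the matrices below, i.+1 and j.+1 are the usual
   indices 1 <= i, j <= N. *)

Definition o_det (N : nat) (a : 'I_N -> int) : Lambda :=
  \det (\matrix_(i < N, j < N)
    (hZ (a i - i.+1%:Z + j.+1%:Z) - hZ (a i - i.+1%:Z - j.+1%:Z))).

(* For N = 0 this is 1/2, the formula being meant for N > 0. *)
Definition sp_det (N : nat) (a : 'I_N -> int) : Lambda :=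
  (2^-1 : rat) *: \det (\matrix_(i < N, j < N)
    (hZ (a i - i.+1%:Z + j.+1%:Z) + hZ (a i - i.+1%:Z - j.+1%:Z + 2))).

Definition so_det (N : nat) (a : 'I_N -> int) : Lambda :=
  \det (\matrix_(i < N, j < N)
    (hZ (a i - i.+1%:Z + j.+1%:Z) + hZ (a i - i.+1%:Z - j.+1%:Z + 1))).

Definition som_det (N : nat) (a : 'I_N -> int) : Lambda :=
  \det (\matrix_(i < N, j < N)
    (hZ (a i - i.+1%:Z + j.+1%:Z) - hZ (a i - i.+1%:Z - j.+1%:Z + 1))).

Definition rs_det (N M : nat) (a : 'I_N -> int) (b : 'I_M -> int) : Lambda :=
  \det (block_mx
    (\matrix_(i < N, j < N) hZ (a i - i.+1%:Z + j.+1%:Z))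
    (\matrix_(i < N, j < M) hZ (a i - i.+1%:Z - j.+1%:Z + 1))
    (\matrix_(i < M, j < N) hZ (b i - i.+1%:Z - j.+1%:Z + 1))
    (\matrix_(i < M, j < M) hZ (b i - i.+1%:Z + j.+1%:Z))).

(* The length of the partition la is size la. *)
Definition is_partition (la : seq nat) : bool :=
  sorted geq la && (0%N \notin la).

(* Parts are indexed from 1: part la i = la_i, which is 0 for i > size la. *)
Definition part (la : seq nat) (i : nat) : int := (nth 0%N la i.-1)%:Z.

(* Main.v *)
(** Write H_k for the column with entries h_{lambda_i - i + k}. Every matrix
in the theorem has columns made of H_k in the top rows and H_{s-k} in the
bottom rows, for a fixed s. Subtracting bottom rows from top rows (or the
reverse) makes the columns k and s-k opposite in one of the two blocks, so that
adding them pairwise produces a block triangular matrix whose diagonal blocks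
are those of the orthogonal and symplectic determinants.

In the last two identities the two determinants on the left have the same
columns up to a cyclic permutation, and the same rows except that row n+1 is of
bottom type in the first one and of top type in the second one; the permutations
of rows and columns have opposite signs, so by linearity the sum is a single
determinant whose last row is the difference of these two rows. *)
Require Import Defs.
From mathcomp Require Import all_boot all_order all_fingroup all_algebra.
From mathcomp Require Import boolp zify.

Set Implicit Arguments.
Unset Strict Implicit.
Unset Printing Implicit Defensive.

Import GRing.Theory.
Local Open Scope ring_scope.

(** * Block triangular reduction, and moves of rows and columns, over a commutative ring *)

Section BlockDeterminants.
Variable R : comNzRingType.

(** Right multiplication by the unipotent matrix with lower left block [V] adds combinations of the
    right columns to the left ones; the hypothesis makes the result block upper triangular. *)
Lemma det_block_colreduce n1 n2 (A : 'M[R]_n1) (B : 'M_(n1, n2))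
    (C : 'M_(n2, n1)) (D : 'M_n2) (V : 'M_(n2, n1)) :
  C + D *m V = 0 -> \det (block_mx A B C D) = \det (A + B *m V) * \det D.
Proof.
move=> CDV; rewrite -[LHS]mulr1.
have <- : \det (block_mx 1%:M 0 V 1%:M : 'M[R]_(n1 + n2)) = 1.
  by rewrite det_lblock !det1 mulr1.
by rewrite -det_mulmx mulmx_block !mulmx0 !mulmx1 !add0r CDV det_ublock.
Qed.

(** The bottom rows are subtracted from the top ones, then combinations of the left columns given by
    [V] are added to the right ones; the upper right block becomes the left side of the
    hypothesis. *)
Lemma det_block_reduce n (A B C D V : 'M[R]_n) :
  (A - C) *m V + (B - D) = 0 ->
  \det (block_mx A B C D) = \det (A - C) * \det (C *m V + D).
Proof.
move=> ACV; have -> : \det (block_mx A B C D) =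
    \det (block_mx 1%:M (- 1%:M) 0 1%:M *m block_mx A B C D *m
          block_mx 1%:M V 0 1%:M).
  by rewrite !det_mulmx !det_ublock !det1 !mul1r !mulr1.
rewrite !mulmx_block !mulmx0 !mul0mx !mulmx1 !mulNmx !mul1mx.
by rewrite !addr0 !add0r ACV det_lblock.
Qed.

(** On the right it moves columns one step right behind a zero column; on the left it moves rows one
    step up above a zero row. As [V] it pairs column j of one half with column j-1 of the other, as
    the products of orthogonal and symplectic determinants require. *)
Definition shift_mx n : 'M[R]_n := \matrix_(i, j) (i.+1 == j)%:R.

Lemma mulmx_shift m n (f : nat -> nat -> R) :
  (\matrix_(i < m, j < n) f i j) *m shift_mx n =
  \matrix_(i < m, j < n) ((0 < j)%:R * f i j.-1).
Proof.
apply/matrixP => i j; rewrite !mxE.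
have [j0|j_gt0] := posnP j.
  by rewrite mul0r big1 // => k _; rewrite !mxE j0 mulr0.
have ltj : (j.-1 < n)%N by have := ltn_ord j; lia.
rewrite (bigD1 (Ordinal ltj)) //= !mxE /= prednK // eqxx mulr1 mul1r.
rewrite big1 ?addr0 // => k; rewrite -val_eqE !mxE /= => /eqP kj.
by case: eqP => [|_]; [lia | rewrite mulr0].
Qed.

(** [lift_perm a b 1] sends [a] to [b] and keeps the order of the other indices, so it is a cycle
    whose sign is the parity of a + b. *)
Lemma det_row_move n (a b : 'I_n.+1) (A : 'M[R]_n.+1) :
  \det (\matrix_(i, j) A (lift_perm a b 1%g i) j) = (-1) ^+ (a + b) * \det A.
Proof.
have -> : (\matrix_(i, j) A (lift_perm a b 1%g i) j) =
          perm_mx (lift_perm a b 1%g) *m A.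
  by rewrite -row_permE; apply/matrixP => i j; rewrite !mxE.
by rewrite det_mulmx det_perm odd_lift_perm odd_perm1 addbF -oddD signr_odd.
Qed.

Lemma det_col_move n (a b : 'I_n.+1) (A : 'M[R]_n.+1) :
  \det (\matrix_(i, j) A i (lift_perm a b 1%g j)) = (-1) ^+ (a + b) * \det A.
Proof.
rewrite -[in RHS]det_tr -det_row_move -det_tr; congr (\det _).
by apply/matrixP => i j; rewrite !mxE.
Qed.

(** Entries indexed by natural numbers do not see how the size is split, so block matrices of sizes
    [m.+2 + m] and [m.+1 + m.+1] become comparable. *)
Lemma block_mx_nat m n (A : 'M[R]_m) (B : 'M_(m, n)) (C : 'M_(n, m))
    (D : 'M_n) (F : nat -> nat -> R) :
  (forall i j, A i j = F i j) -> (forall i j, B i j = F i (m + j)%N) ->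
  (forall i j, C i j = F (m + i)%N j) ->
  (forall i j, D i j = F (m + i)%N (m + j)%N) ->
  block_mx A B C D = \matrix_(i, j) F i j.
Proof.
move=> AF BF CF DF; apply/matrixP => i j; rewrite [RHS]mxE mxE.
by case: splitP => i' ->; rewrite mxE; case: splitP => j' ->.
Qed.

(** The cycle 0 -> m+1, k -> k-1 for 1 <= k <= m+1, fixing all larger k: the form of
    [lift_perm ord0 p 1] on natural numbers, with p of value m+1. *)
Definition cycle_col m k := if k is k'.+1 then bump m.+1 k' else m.+1.

Lemma det_cycle_rowcol m (T B : nat -> nat -> R) :
  \det (\matrix_(i < m.+2 + m, k < m.+2 + m)
    (if (i < m.+2)%N then T i (cycle_col m k)
     else B (i - m.+1)%N (cycle_col m k))) =
  - \det (\matrix_(i < m.+1 + m.+1, k < m.+1 + m.+1)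
      (if (i < m.+1)%N then T i k
       else if (i < m + m.+1)%N then B (i - m)%N k else T m.+1 k)).
Proof.
have -> : (m.+2 + m = m.+1 + m.+1)%N by lia.
set G := (X in - \det X).
have ltm : (m.+1 < m.+1 + m.+1)%N by lia.
pose p : 'I_(m.+1 + m.+1) := Ordinal ltm.
(* The columns are cycled, and the row of [T m.+1] goes from position m+1 to the last one. The
   exponents add up to 2(m+1) + (2m+1), which is odd. *)
have -> : - \det G = (-1) ^+ (@ord0 (m + m.+1) + p) *
    ((-1) ^+ (p + @ord_max (m + m.+1)) * \det G).
  rewrite mulrA -exprD -signr_odd.
  have -> : odd (@ord0 (m + m.+1) + p + (p + @ord_max (m + m.+1))).
    by rewrite /=; lia.
  by rewrite mulN1r.
rewrite -det_row_move -(det_col_move ord0 p); congr (\det _).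
apply/matrixP => i k; rewrite !mxE.
have -> : lift_perm ord0 p 1%g k = cycle_col m k :> nat.
  case: (unliftP ord0 k) => [j ->|->]; last by rewrite lift_perm_id.
  by rewrite lift_perm_lift perm1.
case: (unliftP p i) => [j ->|->]; last first.
  by rewrite lift_perm_id /=; do !case: ifP => //; lia.
rewrite lift_perm_lift perm1; case: j => j /= ltj.
rewrite /bump (leqNgt (m + m.+1)) ltj add0n.
have [lt_mj|le_jm] := ltnP m j; rewrite ?add0n ?add1n.
  have -> : (j.+1 < m.+2)%N = false by lia.
  have -> : (j < m.+1)%N = false by lia.
  by rewrite ltj subSS.
by rewrite !ltnS le_jm (leqW le_jm).
Qed.

Lemma det_swap_row_type m (T B : nat -> nat -> R) :
  \det (\matrix_(i < m.+1 + m.+1, k < m.+1 + m.+1)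
    (if (i < m.+1)%N then T i k else B (i - m)%N k)) +
  \det (\matrix_(i < m.+2 + m, k < m.+2 + m)
    (if (i < m.+2)%N then T i (cycle_col m k)
     else B (i - m.+1)%N (cycle_col m k))) =
  \det (block_mx
    (\matrix_(i < m.+1, j < m.+1) T i j)
    (\matrix_(i < m.+1, j < m.+1) T i (m.+1 + j)%N)
    (\matrix_(i < m.+1, j < m.+1) (B i.+1 j - T i.+1 j))
    (\matrix_(i < m.+1, j < m.+1) (B i.+1 (m.+1 + j)%N - T i.+1 (m.+1 + j)%N))).
Proof.
rewrite det_cycle_rowcol; set F := \matrix_(i, k) _; set G := \matrix_(i, k) _.
(* [F] and [G] differ only in the last row, [B m.+1] against [T m.+1], so linearity in that row
   gives one determinant. *)
pose E : 'M[R]_(m.+1 + m.+1) := \matrix_(i, k)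
  (if (i < m.+1)%N then T i k else
   if (i < m + m.+1)%N then B (i - m)%N k else B m.+1 k - T m.+1 k).
have -> : \det F - \det G = \det E.
  rewrite (@determinant_multilinear _ _ E F G ord_max 1 (-1)).
  - by rewrite mul1r mulN1r.
  - apply/rowP => k; rewrite !mxE /= mul1r mulN1r ltnn.
    have -> : (m + m.+1 < m.+1)%N = false by lia.
    congr (B _ _ - _); exact/esym/addKn.
  - apply/matrixP => -[i lti] k; rewrite !mxE /= /bump.
    by move: lti => /= lti; rewrite (leqNgt (m + m.+1)) lti add0n lti.
  - apply/matrixP => -[i lti] k; rewrite !mxE /= /bump.
    by move: lti => /= lti; rewrite (leqNgt (m + m.+1)) lti add0n lti.
(* Lower row i < m, equal to [B i.+1], loses the top row [T i.+1]. The zero last row of [S] leaves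
   the last row alone, which is a difference already. *)
pose S : 'M[R]_m.+1 := (shift_mx m.+1).
have -> : \det E = \det (block_mx 1%:M 0 (- S) 1%:M *m E).
  by rewrite det_mulmx det_lblock !det1 !mul1r.
congr (\det _); rewrite -[E]submxK mulmx_block !mul1mx !mul0mx !addr0.
have row_op (f : nat -> nat) :
  - S *m (\matrix_(i < m.+1, j < m.+1) T i (f j)) +
  (\matrix_(i < m.+1, j < m.+1)
    if (i < m)%N then B i.+1 (f j) else B m.+1 (f j) - T m.+1 (f j)) =
  \matrix_(i < m.+1, j < m.+1) (B i.+1 (f j) - T i.+1 (f j)).
  apply/matrixP => i j; rewrite mulNmx !mxE.
  have [im|mi] := ltnP i m.
    have ltim : (i.+1 < m.+1)%N by [].
    rewrite (bigD1 (Ordinal ltim)) //= !mxE /= eqxx mul1r big1 ?addr0 1?addrC //.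
    move=> k; rewrite -val_eqE !mxE /= => /eqP ik.
    by case: eqP => [|_]; [lia | rewrite mul0r].
  have -> : i = m :> nat by have := ltn_ord i; lia.
  rewrite big1 ?oppr0 ?add0r // => k _; rewrite !mxE.
  have -> : i.+1 == k = false by have := ltn_ord k; lia.
  by rewrite mul0r.
have Eu (f : 'I_m.+1 -> 'I_(m.+1 + m.+1)) (g : nat -> nat) :
    (forall j, f j = g j :> nat) ->
  (\matrix_(i < m.+1, j < m.+1) E (lshift m.+1 i) (f j) =
   \matrix_(i < m.+1, j < m.+1) T i (g j)) /\
  (\matrix_(i < m.+1, j < m.+1) E (rshift m.+1 i) (f j) =
   \matrix_(i < m.+1, j < m.+1)
    if (i < m)%N then B i.+1 (g j) else B m.+1 (g j) - T m.+1 (g j)).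
  move=> fg; split; apply/matrixP => i j; rewrite !mxE fg /= ?ltn_ord //.
  have -> : (m.+1 + i < m.+1)%N = false by lia.
  have -> : (m.+1 + i < m + m.+1)%N = (i < m)%N by lia.
  by case: ifP => // _; congr (B _ _); lia.
have [Eul Edl] := @Eu (lshift m.+1) id (fun=> erefl).
have [Eur Edr] := @Eu (@rshift m.+1 m.+1) (addn m.+1) (fun=> erefl).
rewrite -(row_op id) -(row_op (addn m.+1)) -Eul -Edl -Eur -Edr.
by congr block_mx; try congr (_ *m _ + _);
  apply/matrixP => i j; rewrite !mxE.
Qed.

End BlockDeterminants.

(** * Determinants in complete homogeneous symmetric functions *)

Lemma sp_detE m (a : 'I_m.+1 -> int) :
  sp_det a = \det (\matrix_(i < m.+1, j < m.+1)
    (hZ (a i - i.+1%:Z + j.+1%:Z) +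
     (0 < j)%:R * hZ (a i - i.+1%:Z - j.+1%:Z + 2))).
Proof.
rewrite /sp_det; set A := (X in _ *: \det X); set B := (X in _ = \det X).
(* In the first column the two summands coincide, so [A] has twice the first column of [B], which
   absorbs the factor 1/2. Transposition turns it into a row for multilinearity. *)
have -> : \det A = 2%:R * \det B.
  rewrite -det_tr -[in RHS]det_tr.
  rewrite (@determinant_multilinear _ _ A^T B^T B^T ord0 2%:R 0) ?mul0r ?addr0 //.
  - apply/rowP => i; rewrite !mxE /= !mul0r !addr0 mulr_natl mulr2n.
    by congr (_ + hZ _); lia.
  - by apply/matrixP => j i; rewrite !mxE lift0 mul1r.
  - by apply/matrixP => j i; rewrite !mxE lift0 mul1r.
by rewrite mulr_natl -scaler_nat scalerA mulVf ?scale1r.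
Qed.

Lemma subrB_eq0 (V : zmodType) (a b c d : V) :
  a = d -> b = c -> a - b + (c - d) = 0.
Proof. by move=> -> ->; rewrite subrKA subrr. Qed.

Lemma cycle_col_left m k : (0 < k < m.+2)%N -> cycle_col m k = k.-1.
Proof. by case: k => // k /= km; rewrite /bump; case: leqP => //; lia. Qed.

Lemma cycle_col_right m k : (m.+1 < k)%N -> cycle_col m k = k.
Proof. by case: k => // k /= km; rewrite /bump -ltnS km. Qed.

(** In both determinants the top offsets added to t_i - (i+1) run over -m, ..., m+1, and a column of
    top offset e has bottom offset 1-e. Offset 0 comes first in the second determinant but at
    position m+1 in the first, whence [cycle_col]. *)
Lemma rs_det_sum m (t b : nat -> int) :
  rs_det (fun i : 'I_m.+1 => t i) (fun i : 'I_m.+1 => b i.+1) +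
  rs_det (fun i : 'I_m.+2 => t i - 1) (fun i : 'I_m => b i.+1 + 1) =
  \det (block_mx
    (\matrix_(i < m.+1, j < m.+1) hZ (t i - i.+1%:Z + j.+1%:Z))
    (\matrix_(i < m.+1, j < m.+1) hZ (t i - i.+1%:Z - j.+1%:Z + 1))
    (\matrix_(i < m.+1, j < m.+1)
      (hZ (b i.+1 - i.+1%:Z - j.+1%:Z + 1) - hZ (t i.+1 - i.+2%:Z + j.+1%:Z)))
    (\matrix_(i < m.+1, j < m.+1)
      (hZ (b i.+1 - i.+1%:Z + j.+1%:Z) - hZ (t i.+1 - i.+2%:Z - j.+1%:Z + 1)))).
Proof.
pose T (i k : nat) := hZ (t i - i.+1%:Z +
  (if (k < m.+1)%N then k.+1%:Z else m.+1%:Z - k%:Z)).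
(* The rows of [B] in use start at i = 1, so i is already the usual row index; the [+ 1] compensates
   [i.+1]. *)
pose B (i k : nat) := hZ (b i - i.+1%:Z + 1 +
  (if (k < m.+1)%N then 1 - k.+1%:Z else k%:Z - m%:Z)).
pose F1 i k := if (i < m.+1)%N then T i k else B (i - m)%N k.
pose F2 i k := if (i < m.+2)%N then T i (cycle_col m k)
               else B (i - m.+1)%N (cycle_col m k).
have T_cycle i k : T i (cycle_col m k) =
    hZ (t i - i.+1%:Z + (if (k < m.+2)%N then k%:Z else m.+1%:Z - k%:Z)).
  rewrite /T; congr (hZ (_ + _)); have [km|mk] := ltnP k m.+2; last first.
    by rewrite cycle_col_right //; case: ifP => //; lia.
  have [->|k_gt0] := posnP k; first by rewrite /= ltnn subrr.
  by rewrite cycle_col_left ?k_gt0 //; case: ifP; lia.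
have B_cycle i k : B i (cycle_col m k) =
    hZ (b i - i.+1%:Z + 1 + (if (k < m.+2)%N then 1 - k%:Z else k%:Z - m%:Z)).
  rewrite /B; congr (hZ (_ + _)); have [km|mk] := ltnP k m.+2; last first.
    by rewrite cycle_col_right //; case: ifP => //; lia.
  have [->|k_gt0] := posnP k; first by rewrite /= ltnn; lia.
  by rewrite cycle_col_left ?k_gt0 //; case: ifP; lia.
rewrite /rs_det (@block_mx_nat _ _ _ _ _ _ _ F1); first last.
- move=> i j; rewrite mxE /F1 /B !ltnNge !leq_addr /=; congr hZ.
  have -> : (m.+1 + i - m = i.+1)%N by lia.
  by lia.
- move=> i j; rewrite mxE /F1 /B ltnNge leq_addr ltn_ord /=; congr hZ.
  have -> : (m.+1 + i - m = i.+1)%N by lia.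
  by lia.
- move=> i j; rewrite mxE /F1 /T (ltnNge (_ + _)) leq_addr ltn_ord /=.
  by congr hZ; lia.
- by move=> i j; rewrite mxE /F1 /T !ltn_ord.
rewrite (@block_mx_nat _ _ _ _ _ _ _ F2); first last.
- move=> i j; rewrite mxE /F2 B_cycle !ltnNge !leq_addr /=; congr hZ.
  have -> : (m.+2 + i - m.+1 = i.+1)%N by lia.
  by lia.
- move=> i j; rewrite mxE /F2 B_cycle ltnNge leq_addr ltn_ord /=; congr hZ.
  have -> : (m.+2 + i - m.+1 = i.+1)%N by lia.
  by lia.
- move=> i j; rewrite mxE /F2 T_cycle (ltnNge (_ + _)) leq_addr ltn_ord /=.
  by congr hZ; lia.
- move=> i j; rewrite mxE /F2 T_cycle !ltn_ord; congr hZ; lia.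
rewrite det_swap_row_type.
congr (\det (block_mx _ _ _ _)); apply/matrixP => i j; rewrite !mxE /T /B;
  have := ltn_ord i; have := ltn_ord j => *;
  rewrite ?ltn_ord ?ltnNge ?leq_addr //=;
  try congr (_ - _); congr hZ; lia.
Qed.
Theorem theorem6p3 (n : nat) (n_gt0 : (0 < n)%N) :
  (forall la : seq nat, is_partition la -> (size la <= n)%N ->
     rs_det (fun i : 'I_n => part la i.+1) (fun i : 'I_n => part la i.+1) =
       so_det (fun i : 'I_n => part la i.+1) *
       som_det (fun i : 'I_n => part la i.+1) /\
     rs_det (fun i : 'I_n => part la i.+1 + 1) (fun i : 'I_n => part la i.+1) =
       o_det (fun i : 'I_n => part la i.+1 + 1) *
       sp_det (fun i : 'I_n => part la i.+1)) /\
  (forall la : seq nat, is_partition la -> (size la <= n.+1)%N ->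
     rs_det (fun i : 'I_n => part la i.+1) (fun i : 'I_n => part la i.+2) +
     rs_det (fun i : 'I_n.+1 => part la i.+1 - 1)
            (fun i : 'I_n.-1 => part la i.+2 + 1) =
       sp_det (fun i : 'I_n => part la i.+1) *
       o_det (fun i : 'I_n => part la i.+2) /\
     rs_det (fun i : 'I_n => part la i.+1 + 1) (fun i : 'I_n => part la i.+2) +
     rs_det (fun i : 'I_n.+1 => part la i.+1)
            (fun i : 'I_n.-1 => part la i.+2 + 1) =
       so_det (fun i : 'I_n => part la i.+1 + 1) *
       som_det (fun i : 'I_n => part la i.+2)).
Proof.
case: n n_gt0 => // m _; split=> la _ _; split.
(* The two diagonal blocks agree, and so do the two off-diagonal ones, so equal column positions
   pair up: [V] is the identity. *)
- rewrite /rs_det (@det_block_reduce _ _ _ _ _ _ 1%:M).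
    rewrite mulmx1 mulrC /so_det /som_det; congr (_ * _); congr (\det _).
      by apply/matrixP => i j; rewrite !mxE addrC.
    by apply/matrixP => i j; rewrite !mxE.
  by rewrite mulmx1 addrC subrKA subrr.
- rewrite sp_detE /rs_det /o_det.
  pose f (i j : nat) := hZ (part la i.+1 - i.+1%:Z - j.+1%:Z + 1).
  pose g (i j : nat) := hZ (part la i.+1 + 1 - i.+1%:Z + j.+1%:Z).
  (* Right column j is paired with left column j-1. The first right column has equal top and bottom
     entries, so the subtraction already clears it. *)
  rewrite (@det_block_reduce _ _ _ _ _ _ (shift_mx _ _)).
    rewrite (mulmx_shift _ _ f) /f; congr (_ * _); congr (\det _).
      by apply/matrixP => i j; rewrite !mxE; congr (_ - hZ _); lia.
    apply/matrixP => i j; rewrite !mxE addrC; congr (_ + _).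
    by case: (val j) => [|j'] /=; rewrite ?mul0r // !mul1r; congr hZ; lia.
  rewrite mulmxBl (mulmx_shift _ _ f) (mulmx_shift _ _ g).
  apply/matrixP => i j; rewrite !mxE /f /g.
  case: (val j) => [|j'] /=; rewrite ?mul0r ?mul1r ?subrr ?add0r.
    by apply/eqP; rewrite subr_eq0; apply/eqP; congr hZ; lia.
  by apply: subrB_eq0; congr hZ; lia.
- rewrite sp_detE /o_det.
  rewrite [LHS](rs_det_sum m (fun i => part la i.+1) (fun i => part la i.+1)).
  pose f (i j : nat) := hZ (part la i.+1 - i.+1%:Z - j.+1%:Z + 1).
  pose g (i j : nat) := hZ (part la i.+2 - i.+1%:Z + j.+1%:Z) -
                        hZ (part la i.+2 - i.+2%:Z - j.+1%:Z + 1).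
  (* In the lower blocks, left column j is cancelled by right column j-1, and the first left column
     is zero. *)
  rewrite (@det_block_colreduce _ _ _ _ _ _ _ (shift_mx _ _)).
    rewrite (mulmx_shift _ _ f) /f; congr (_ * _); congr (\det _).
      apply/matrixP => i j; rewrite !mxE; congr (_ + _).
      by case: (val j) => [|j'] /=; rewrite ?mul0r // !mul1r; congr hZ; lia.
    by apply/matrixP => i j; rewrite !mxE; congr (_ - hZ _); lia.
  rewrite (mulmx_shift _ _ g); apply/matrixP => i j; rewrite !mxE /g.
  case: (val j) => [|j'] /=; rewrite ?mul0r ?mul1r ?addr0.
    by apply/eqP; rewrite subr_eq0; apply/eqP; congr hZ; lia.
  by apply: subrB_eq0; congr hZ; lia.
(* Writing the parts as [+ 1 - 1] matches the second summand of [rs_det_sum] when t is the partition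
   raised by one. *)
- have -> : rs_det (fun i : 'I_m.+2 => part la i.+1)
                   (fun i : 'I_m => part la i.+2 + 1) =
            rs_det (fun i : 'I_m.+2 => part la i.+1 + 1 - 1)
                   (fun i : 'I_m => part la i.+2 + 1).
    by congr rs_det; apply: functional_extensionality_dep => i; rewrite addrK.
  rewrite [LHS](rs_det_sum m (fun i => part la i.+1 + 1)
                             (fun i => part la i.+1)).
  rewrite (@det_block_colreduce _ _ _ _ _ _ _ 1%:M) mulmx1.
    rewrite /so_det /som_det; congr (_ * _); congr (\det _).
      by apply/matrixP => i j; rewrite !mxE.
    by apply/matrixP => i j; rewrite !mxE; congr (_ - hZ _); lia.
  apply/matrixP => i j; rewrite !mxE.
  by apply: subrB_eq0; congr hZ; lia.
Qed.
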